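(* Let $\vec I=\langle I_n:n\in\omega\rangle$ be an $\omega$-cofinal tower of normal ideals. (1) If $\vec I$ is precipitous, then $\vec I$ is a canonical projection of NS. (2) If the dual of each $I_n$ is an ultrafilter, then $\vec I$ has wellfounded ultrapower if and only if $\vec I$ is a canonical projection of NS.
   Context: A tower of normal ideals of height $\lambda$ is a sequence $\langle I_x:x\in V_\lambda\rangle$ with the following properties: - each $I_x$ is a normal, fine, countably complete ideal on $\wp(x)$; - for $x\subseteq y$, $I_x$ is the canonical projection of $I_y$, i.e. $A\in I_x\iff\{M\subseteq y:M\cap x\in A\}\in I_y$. It is $\omega$-cofinal if $\mathrm{cf}(\lambda)=\omega$. In that case, fixing cardinals $\kappa_n$ increasing and cofinal in $\lambda$, the tower is generated by (and identified with) $\langle I_n:n\in\omega\rangle$, where $I_n=I_{V_{\kappa_n}}$. The associated forcing $\mathbb B_{\vec I}$ consists of the positive sets $T\in I_x^+$ ($x\in V_\lambda$), ordered by $T\le T'$ iff the lift of $T$ is below the lift of $T'$ modulo the ideal at a common larger $x$. A generic $G$ yields the generic ultrapower $j_G:V\to\mathrm{Ult}(V,G)$ (direct limit of ultrapowers by the induced $V$-ultrafilters on the $\wp(x)$). $\vec I$ is precipitous if this ultrapower is forced to be wellfounded. When every $I_n$ is the dual of an ultrafilter, the forcing is trivial and $\vec I$ has a (ground-model) ultrapower $\mathrm{Ult}(V,\vec I)$. For a stationary set $S$, $\mathrm{NS}\restriction S$ is the nonstationary ideal restricted to $S$. Here $S$ is stationary if every $f:[\bigcup S]^{<\omega}\to\bigcup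 S$ has a closure point in $S$, and $\mathrm{NS}\restriction S$ is generated by the complement of $S$ together with the sets of non-closure-points of such $f$. $\vec I$ is a canonical projection of NS if there is a stationary $S$ with $V_\lambda\subseteq\bigcup S$ such that for every $x\in V_\lambda$ and $A\subseteq\wp(x)$: $A\in I_x\iff\{M\in S:M\cap x\in A\}\in\mathrm{NS}\restriction S$. *)

(* Defs.v *)
(* Plain Rocq (no MathComp).  The set-theoretic universe is an arbitrary model
   (V, ∈) of second-order ZFC: Separation and Replacement range over all
   predicates and functions on V.  In particular class functions V -> V
   restricted to a set are functions of the model, and nat-indexed sequences are
   its ω-sequences. *)
From Stdlib Require Import ClassicalEpsilon FunctionalExtensionality.

Set Implicit Arguments.
Unset Strict Implicit.
Unset Printing Implicit Defensive.

Structure ZFC : Type := {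
  carrier :> Type;
  mem : carrier -> carrier -> Prop;
  upair : carrier -> carrier -> carrier;
  sUnion : carrier -> carrier;
  power : carrier -> carrier;
  sep : carrier -> (carrier -> Prop) -> carrier;
  image : carrier -> (carrier -> carrier) -> carrier;
  inf : carrier;
  extensionality : forall x y, (forall z, mem z x <-> mem z y) -> x = y;
  foundation : well_founded mem;
  pairing : forall x y z, mem z (upair x y) <-> z = x \/ z = y;
  union : forall x z, mem z (sUnion x) <-> exists y, mem y x /\ mem z y;
  powerset : forall x z, mem z (power x) <-> (forall w, mem w z -> mem w x);
  separation : forall x Q z, mem z (sep x Q) <-> mem z x /\ Q z;
  replacement : forall x F z,
    mem z (image x F) <-> exists y, mem y x /\ z = F y;
  infinity_zero : exists e, (forall z, ~ mem z e) /\ mem e inf;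
  infinity_succ : forall x, mem x inf ->
    exists y, (forall z, mem z y <-> mem z x \/ z = x) /\ mem y inf;
  choice : forall a,
    (forall x, mem x a -> exists z, mem z x) ->
    (forall x y z, mem x a -> mem y a -> mem z x -> mem z y -> x = y) ->
    exists c, forall x, mem x a -> exists! z, mem z c /\ mem z x
}.

Arguments inf {_}.

Notation "x ∈ y" := (mem x y) (at level 70, no associativity).
Notation "x ⊆ y" := (forall w, w ∈ x -> w ∈ y) (at level 70, no associativity).

Section Sets.
Context {V : ZFC}.
Implicit Types a b x y z : V.

Definition empty : V := sep inf (fun _ => False).
Definition cup x y : V := sUnion (upair x y).
Definition cap x y : V := sep x (fun z => z ∈ y).
Definition diff x y : V := sep x (fun z => ~ z ∈ y).
Definition succ x : V := cup x (upair x x).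
Definition opair x y : V := upair (upair x x) (upair x y).

Definition inductive_set a : Prop :=
  empty ∈ a /\ forall x, x ∈ a -> succ x ∈ a.
Definition omega : V := sep inf (fun n => forall a, inductive_set a -> n ∈ a).

Inductive finite_set : V -> Prop :=
| finite_empty : finite_set empty
| finite_add a x : finite_set a -> finite_set (cup a (upair x x)).

Definition is_fun_on (f d : V) : Prop :=
  (forall z, z ∈ f -> exists u v, u ∈ d /\ z = opair u v) /\
  (forall u, u ∈ d -> exists! v, opair u v ∈ f).

Definition mem_rec (H : V -> (V -> V) -> V) : V -> V :=
  Fix (@foundation V) (fun _ => carrier V)
    (fun a rec => H a (fun b =>
       match excluded_middle_informative (b ∈ a) with
       | left h => rec b h
       | right _ => empty
       end)).

Lemma mem_recE (H : V -> (V -> V) -> V) a :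
  mem_rec H a = H a (fun b =>
    if excluded_middle_informative (b ∈ a) then mem_rec H b else empty).
Proof.
unfold mem_rec at 1; rewrite Fix_eq; [reflexivity|].
intros x f g Hfg; f_equal; apply functional_extensionality; intros b.
destruct (excluded_middle_informative _); auto.
Qed.

(* the cumulative hierarchy: V_a is the union of the ℘(V_b), b ∈ a *)
Definition Vset : V -> V :=
  mem_rec (fun a W => sUnion (image a (fun b => power (W b)))).

Lemma in_Vset a x : x ∈ Vset a <-> exists b, b ∈ a /\ x ⊆ Vset b.
Proof.
unfold Vset at 1; rewrite mem_recE, union; split.
- intros [y [Hy Hx]]; apply replacement in Hy; destruct Hy as [b [Hb ->]].
  exists b; split; [exact Hb|].
  destruct (excluded_middle_informative _); [|contradiction].
  now apply powerset.
- intros [b [Hb Hx]]; exists (power (Vset b)); split; [|now apply powerset].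
  apply replacement; exists b; split; [exact Hb|].
  now destruct (excluded_middle_informative _).
Qed.

Definition is_transitive a : Prop := forall b, b ∈ a -> b ⊆ a.
Definition is_ordinal a : Prop :=
  is_transitive a /\ forall b, b ∈ a -> is_transitive b.

Definition is_cardinal k : Prop :=
  is_ordinal k /\
  forall a, a ∈ k -> ~ exists f : V -> V,
    (forall x, x ∈ k -> f x ∈ a) /\
    (forall x y, x ∈ k -> y ∈ k -> f x = f y -> x = y).

Definition cofinal_map (mu lam : V) (f : V -> V) : Prop :=
  (forall i, i ∈ mu -> f i ∈ lam) /\
  (forall a, a ∈ lam -> exists i, i ∈ mu /\ (a ∈ f i \/ a = f i)).

Definition is_cofinality (lam mu : V) : Prop :=
  is_ordinal mu /\ (exists f, cofinal_map mu lam f) /\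
  (forall nu, nu ∈ mu -> ~ exists f, cofinal_map nu lam f).

Definition increasing_cofinal (kap : nat -> V) (lam : V) : Prop :=
  (forall n, kap n ∈ kap (S n)) /\ (forall n, kap n ∈ lam) /\
  (forall a, a ∈ lam -> exists n, a ∈ kap n).

End Sets.

Section Ideals.
Context {V : ZFC}.
Implicit Types x y A B I U Z : V.

Definition is_ideal Z I : Prop :=
  (forall A, A ∈ I -> A ⊆ Z) /\
  empty ∈ I /\ ~ Z ∈ I /\
  (forall A B, B ∈ I -> A ⊆ B -> A ∈ I) /\
  (forall A B, A ∈ I -> B ∈ I -> cup A B ∈ I).

Definition countably_complete Z I : Prop :=
  forall F : nat -> V, (forall n, F n ∈ I) ->
    sep Z (fun M => exists n, M ∈ F n) ∈ I.

Definition fine x I : Prop :=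
  forall a, a ∈ x -> sep (power x) (fun M => ~ a ∈ M) ∈ I.

(* closure under diagonal unions *)
Definition normal x I : Prop :=
  forall F : V -> V, (forall a, a ∈ x -> F a ∈ I) ->
    sep (power x) (fun M => exists a, a ∈ M /\ M ∈ F a) ∈ I.

Definition positive Z I A : Prop := A ⊆ Z /\ ~ A ∈ I.

Definition dual Z I : V := sep (power Z) (fun A => diff Z A ∈ I).

Definition is_ultrafilter Z U : Prop :=
  (forall A, A ∈ U -> A ⊆ Z) /\
  Z ∈ U /\ ~ empty ∈ U /\
  (forall A B, A ∈ U -> A ⊆ B -> B ⊆ Z -> B ∈ U) /\
  (forall A B, A ∈ U -> B ∈ U -> cap A B ∈ U) /\
  (forall A, A ⊆ Z -> A ∈ U \/ diff Z A ∈ U).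

Definition lift x y A : V := sep (power y) (fun M => cap M x ∈ A).

Definition is_tower (lam : V) (I : V -> V) : Prop :=
  (forall x, x ∈ Vset lam ->
     is_ideal (power x) (I x) /\ normal x (I x) /\ fine x (I x) /\
     countably_complete (power x) (I x)) /\
  (forall x y, x ∈ Vset lam -> y ∈ Vset lam -> x ⊆ y ->
     forall A, A ⊆ power x -> (A ∈ I x <-> lift x y A ∈ I y)).

End Ideals.

Section Stationary.
Context {V : ZFC}.
Implicit Types (S M X A B : V) (f : V -> V).

Definition finitary_fun X f : Prop :=
  forall a, finite_set a -> a ⊆ X -> f a ∈ X.

Definition closure_point f M : Prop :=
  forall a, finite_set a -> a ⊆ M -> f a ∈ M.

Definition stationary S : Prop :=
  forall f, finitary_fun (sUnion S) f -> exists M, M ∈ S /\ closure_point f M.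

(* NS↾S, the ideal on ℘(⋃S) generated by the first two clauses *)
Inductive NS_restr S : V -> Prop :=
| NS_compl : NS_restr S (diff (power (sUnion S)) S)
| NS_nonclosed f : finitary_fun (sUnion S) f ->
    NS_restr S (sep (power (sUnion S)) (fun M => ~ closure_point f M))
| NS_cup A B : NS_restr S A -> NS_restr S B -> NS_restr S (cup A B)
| NS_subset A B : NS_restr S B -> A ⊆ B -> NS_restr S A.

Definition canonical_projection_of_NS (lam : V) (I : V -> V) : Prop :=
  exists S, stationary S /\ Vset lam ⊆ sUnion S /\
    forall x, x ∈ Vset lam -> forall A, A ⊆ power x ->
      (A ∈ I x <-> NS_restr S (sep S (fun M => cap M x ∈ A))).

End Stationary.

(* The forcing relation for a preorder [le] on a set [P], by Cohen's recursion.
   A statement of the forcing language is represented by the class of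
   conditions that force it. *)
Section Forcing.
Context {V : ZFC} (P : V) (le : V -> V -> Prop).

Definition extends (q p : V) : Prop := q ∈ P /\ p ∈ P /\ le q p.
Notation "q ≼ p" := (extends q p) (at level 70, no associativity).

Definition dense_below (p : V) (D : V -> Prop) : Prop :=
  forall q, q ≼ p -> exists r, r ≼ q /\ D r.

Inductive is_name : V -> Prop :=
| name_intro s :
    (forall z, z ∈ s -> exists t p, z = opair t p /\ is_name t /\ p ∈ P) ->
    is_name s.

(* No greatest condition is assumed, so every condition decorates every
   element of a check name. *)
Definition check : V -> V :=
  mem_rec (fun a c => sUnion (image a (fun b =>
    image P (fun p => opair (c b) p)))).

Lemma in_check a z :
  z ∈ check a <-> exists b p, b ∈ a /\ p ∈ P /\ z = opair (check b) p.
Proof.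
unfold check at 1; rewrite mem_recE, union; split.
- intros [y [Hy Hz]]; apply replacement in Hy; destruct Hy as [b [Hb ->]].
  apply replacement in Hz; destruct Hz as [p [Hp ->]].
  exists b, p; split; [exact Hb|split; [exact Hp|]].
  now destruct (excluded_middle_informative _).
- intros [b [p [Hb [Hp ->]]]].
  exists (image P (fun p => opair (check b) p)); split.
  + apply replacement; exists b; split; [exact Hb|].
    now destruct (excluded_middle_informative _).
  + apply replacement; now exists p.
Qed.

Definition generic_name : V := image P (fun p => opair (check p) p).

(* Both clauses recurse to elements of the two names, so the least relation
   satisfying them is the one given by ∈-recursion. *)
Inductive forces_eq : V -> V -> V -> Prop :=
| forces_eq_intro p s t :
    (forall s' u, opair s' u ∈ s -> forall q, q ≼ p -> exists r, r ≼ q /\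
       (r ≼ u -> exists t' v, opair t' v ∈ t /\ r ≼ v /\ forces_eq r s' t')) ->
    (forall t' v, opair t' v ∈ t -> forall q, q ≼ p -> exists r, r ≼ q /\
       (r ≼ v -> exists s' u, opair s' u ∈ s /\ r ≼ u /\ forces_eq r s' t')) ->
    forces_eq p s t.

Definition Feq (s t : V) : V -> Prop := fun p => forces_eq p s t.

Definition Fmem (s t : V) : V -> Prop := fun p =>
  dense_below p (fun r =>
    exists t' v, opair t' v ∈ t /\ r ≼ v /\ forces_eq r s t').

Definition Fand (A B : V -> Prop) : V -> Prop := fun p => A p /\ B p.
Definition Fnot (A : V -> Prop) : V -> Prop := fun p =>
  forall q, q ≼ p -> ~ A q.
Definition Fimp (A B : V -> Prop) : V -> Prop := fun p =>
  forall q, q ≼ p -> A q -> B q.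
Definition Fall (A : V -> V -> Prop) : V -> Prop := fun p =>
  forall s, is_name s -> A s p.
Definition Fex (A : V -> V -> Prop) : V -> Prop := fun p =>
  dense_below p (fun r => exists s, is_name s /\ A s r).
(* existential quantification over a class [C] of the ground model *)
Definition Fex_ground (C : V -> Prop) (A : V -> V -> Prop) : V -> Prop :=
  fun p => dense_below p (fun r => exists a, C a /\ A a r).

End Forcing.

Section Ultrapowers.
Context {V : ZFC} (lam : V) (I : V -> V).

(* A condition T determines its x, namely x = ⋃T, by fineness. *)
Definition is_condition (T : V) : Prop :=
  exists x, x ∈ Vset lam /\ positive (power x) (I x) T.

Definition B_tower : V := sep (power (power (Vset lam))) is_condition.

Definition B_le (T T' : V) : Prop :=
  exists x x' y, x ∈ Vset lam /\ x' ∈ Vset lam /\ y ∈ Vset lam /\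
    positive (power x) (I x) T /\ positive (power x') (I x') T' /\
    x ⊆ y /\ x' ⊆ y /\
    diff (lift x y T) (lift x' y T') ∈ I y.

(* The ultrapowers below are given by their representing functions f : ℘(x) -> V
   and the membership relation induced on them; wellfoundedness is insensitive
   to passing to the quotient. *)
Definition represents (f : V) : Prop :=
  exists x, x ∈ Vset lam /\ is_fun_on f (power x).

(* A = {M ⊆ y : f(M ∩ x) ∈ g(M ∩ x')}, for dom f = ℘(x) and dom g = ℘(x') *)
Definition membership_set (f g y A : V) : Prop :=
  exists x x', x ∈ Vset lam /\ x' ∈ Vset lam /\ y ∈ Vset lam /\
    is_fun_on f (power x) /\ is_fun_on g (power x') /\ x ⊆ y /\ x' ⊆ y /\
    A = sep (power y) (fun M => exists u v,
          opair (cap M x) u ∈ f /\ opair (cap M x') v ∈ g /\ u ∈ v).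

Local Notation check := (check B_tower).
Local Notation Feq := (Feq B_tower B_le).
Local Notation Fmem := (Fmem B_tower B_le).
Local Notation Fnot := (Fnot B_tower B_le).
Local Notation Fimp := (Fimp B_tower B_le).
Local Notation Fall := (Fall B_tower).
Local Notation Fex := (Fex B_tower B_le).
Local Notation Fex_ground := (Fex_ground B_tower B_le).

(* s E t in Ult(V, G).  The V-ultrafilter induced by G on ℘(y) is G ∩ I_y^+. *)
Definition Fult_mem (s t : V) : V -> Prop :=
  Fex_ground represents (fun f => Fex_ground represents (fun g =>
    Fand (Fand (Feq s (check f)) (Feq t (check g)))
      (Fex_ground
        (fun A => exists y,
           membership_set f g y A /\ positive (power y) (I y) A)
        (fun A => Fmem (check A) (generic_name B_tower))))).

(* every nonempty set of elements of Ult(V, G) has an E-minimal element *)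
Definition Fult_wellfounded : V -> Prop :=
  Fall (fun X =>
    Fimp
      (Fand (Fex (fun s => Fmem s X))
            (Fall (fun s => Fimp (Fmem s X)
               (Fex_ground represents (fun f => Feq s (check f))))))
      (Fex (fun s => Fand (Fmem s X)
         (Fall (fun t => Fimp (Fmem t X) (Fnot (Fult_mem t s))))))).

Definition precipitous : Prop :=
  forall p, p ∈ B_tower -> Fult_wellfounded p.

(* the ultrapower of V by the dual filters, when these are ultrafilters *)
Definition ult_mem (f g : V) : Prop :=
  exists y A, membership_set f g y A /\ A ∈ dual (power y) (I y).

Definition ult_wellfounded : Prop :=
  forall X : V, (exists f, f ∈ X) -> (forall f, f ∈ X -> represents f) ->
    exists f, f ∈ X /\ forall g, g ∈ X -> ~ ult_mem g f.

End Ultrapowers.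

(* Main.v *)
(* Call M ⊆ V_lam good if M ∩ x ∉ A whenever x, A ∈ M and A ∈ I_x, and let S be
   the set of good sets.  The real point is that every F : [V_lam]^{<ω} -> V_lam
   and every T ∈ I_x^+ admit a good M closed under F with M ∩ x ∈ T.  By
   normality, for almost all N ∈ ℘(V_{kap n}) with N ∩ x ∈ T, N is an
   approximation to such an M at level n, and an infinite branch through the
   tree of approximations has such an M as its union.  If there were no branch,
   the ranks of the nodes N ∩ V_{kap n} would define functions f_n on
   ℘(V_{kap n}) with f_{n+1} below f_n almost everywhere on T, so T would force
   the (generic) ultrapower to be illfounded.
   Conversely, a descending sequence in the ultrapower by ultrafilters gives
   countably many sets whose complements are nonstationary relative to the given
   stationary set.  One function codes countably many closure conditions, so a
   single M of that set traces into all of them, and evaluating the sequence at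
   the traces of M gives an infinite ∈-descent. *)
Require Import Defs.
From Stdlib Require Import ClassicalEpsilon Classical Lia Arith Cantor.

Set Implicit Arguments.
Unset Strict Implicit.

(** * Elementary set theory: pairs, graphs of functions, the cumulative hierarchy *)

Section SetBasics.
Context {V : ZFC}.
Implicit Types a b d f x y z A B M : V.

Lemma in_cup x y z : z ∈ cup x y <-> z ∈ x \/ z ∈ y.
Proof.
unfold cup; rewrite union; split.
- intros [w [Hw H]]; apply pairing in Hw; destruct Hw as [-> | ->]; auto.
- intros [H | H]; [exists x | exists y]; rewrite pairing; auto.
Qed.

Lemma in_cap x y z : z ∈ cap x y <-> z ∈ x /\ z ∈ y.
Proof. unfold cap; rewrite separation; tauto. Qed.

Lemma in_diff x y z : z ∈ diff x y <-> z ∈ x /\ ~ z ∈ y.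
Proof. unfold diff; rewrite separation; tauto. Qed.

Lemma not_in_empty z : ~ z ∈ empty.
Proof. unfold empty; rewrite separation; tauto. Qed.

Lemma in_lift x y A M : M ∈ lift x y A <-> M ⊆ y /\ cap M x ∈ A.
Proof. unfold lift; rewrite separation, powerset; tauto. Qed.

Lemma subset_antisym x y : x ⊆ y -> y ⊆ x -> x = y.
Proof. intros H1 H2; apply extensionality; split; auto. Qed.

Lemma empty_cup x : cup empty x = x.
Proof.
apply extensionality; intros z; rewrite in_cup.
pose proof (@not_in_empty z); tauto.
Qed.

Lemma finite_singleton x : finite_set (upair x x).
Proof. rewrite <- (empty_cup (upair x x)); constructor; constructor. Qed.

Lemma mem_irrefl x : ~ x ∈ x.
Proof. induction (foundation x) as [x _ IH]; intros H; exact (IH x H H). Qed.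

Lemma no_descending_sequence (u : nat -> V) : ~ forall n, u (S n) ∈ u n.
Proof.
intros H.
enough (E : forall x n, u n <> x) by exact (E _ 0 eq_refl).
intros x; induction (foundation x) as [x _ IH]; intros n <-.
exact (IH _ (H n) (S n) eq_refl).
Qed.

Lemma cap_cap x y M : x ⊆ y -> cap (cap M y) x = cap M x.
Proof.
intros H; apply extensionality; intros z; rewrite !in_cap; firstorder.
Qed.

Lemma cap_subset_eq x M : M ⊆ x -> cap M x = M.
Proof. intros H; apply extensionality; intros z; rewrite in_cap; firstorder. Qed.

Lemma upair_inj_r x y z : upair x y = upair x z -> y = z.
Proof.
intros H.
assert (Hy : y ∈ upair x z) by (rewrite <- H, pairing; auto).
assert (Hz : z ∈ upair x y) by (rewrite H, pairing; auto).
apply pairing in Hy; apply pairing in Hz.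
destruct Hy, Hz; congruence.
Qed.

Lemma opair_inj x y x' y' : opair x y = opair x' y' -> x = x' /\ y = y'.
Proof.
unfold opair; intros H.
assert (Hx : x = x').
{ assert (H1 : upair x x ∈ upair (upair x' x') (upair x' y'))
    by (rewrite <- H, pairing; auto).
  apply pairing in H1.
  assert (H2 : x' ∈ upair x x)
    by (destruct H1 as [-> | ->]; rewrite pairing; auto).
  apply pairing in H2; destruct H2; congruence. }
subst x'; split; [reflexivity|].
exact (upair_inj_r (upair_inj_r H)).
Qed.

Lemma power_inj x y : power x = power y -> x = y.
Proof.
intros H; apply subset_antisym; apply powerset; [rewrite <- H | rewrite H];
  apply powerset; auto.
Qed.

Lemma is_fun_on_dom f d d' : is_fun_on f d -> is_fun_on f d' -> d = d'.
Proof.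
assert (K : forall e e' : V, is_fun_on f e -> is_fun_on f e' -> e ⊆ e').
{ intros e e' [_ H] [H' _] u Hu.
  destruct (H u Hu) as [v [Hv _]].
  destruct (H' _ Hv) as [u' [v' [Hu' E]]].
  apply opair_inj in E; destruct E; congruence. }
intros H H'; apply subset_antisym; apply K; assumption.
Qed.

Lemma is_fun_on_graph d (F : V -> V) :
  is_fun_on (image d (fun u => opair u (F u))) d.
Proof.
split.
- intros z Hz; apply replacement in Hz; destruct Hz as [u [Hu ->]]; eauto.
- intros u Hu; exists (F u); split.
  + apply replacement; eauto.
  + intros v Hv; apply replacement in Hv; destruct Hv as [u' [_ E]].
    apply opair_inj in E; destruct E; congruence.
Qed.

Lemma in_graph d (F : V -> V) u v :
  opair u v ∈ image d (fun u => opair u (F u)) <-> u ∈ d /\ v = F u.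
Proof.
rewrite replacement; split.
- intros [u' [Hu E]]; apply opair_inj in E; destruct E; subst; auto.
- intros [Hu ->]; eauto.
Qed.

(** Replacement takes functions on V, while [nat] lives outside V. The distinct points [e n] of a
    set serve as internal indices, from which n is recovered by choice. *)
Lemma range_set (X : V) (e F : nat -> V) :
  (forall n, e n ∈ X) -> (forall m n, e m = e n -> m = n) ->
  exists s, forall z, z ∈ s <-> exists n, z = F n.
Proof.
intros He Hinj.
exists (image (sep X (fun z => exists n, z = e n))
          (fun z => F (epsilon (inhabits 0) (fun n => z = e n)))).
assert (K : forall n, epsilon (inhabits 0) (fun m => e n = e m) = n).
{ intros n; symmetry; apply Hinj.
  apply (epsilon_spec (inhabits 0) (fun m => e n = e m)); eauto. }
intros z; rewrite replacement; split.
- intros [y [_ ->]]; eauto.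
- intros [n ->]; exists (e n); rewrite separation, K; eauto.
Qed.

Lemma Vset_mono a b : is_transitive b -> a ∈ b -> Vset a ⊆ Vset b.
Proof.
intros Hb Hab z Hz; apply in_Vset in Hz; destruct Hz as [c [Hc Hz]].
apply in_Vset; exists c; split; [exact (Hb a Hab c Hc) | exact Hz].
Qed.

Lemma Vset_transitive a : is_transitive a -> is_transitive (Vset a).
Proof.
intros Ha x Hx z Hz; apply in_Vset in Hx; destruct Hx as [b [Hb Hx]].
apply (Vset_mono Ha Hb); auto.
Qed.

Lemma Vset_in a b : a ∈ b -> Vset a ∈ Vset b.
Proof. intros H; apply in_Vset; exists a; auto. Qed.

Lemma finite_avoids_tail (e : nat -> V) a :
  (forall m n, e m = e n -> m = n) -> finite_set a ->
  exists k, forall j, k <= j -> ~ e j ∈ a.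
Proof.
intros Hinj; induction 1 as [|a x _ [k Hk]].
- exists 0; intros j _; apply not_in_empty.
- destruct (classic (exists i, e i = x)) as [[i <-] | Hx].
  + exists (max k (S i)); intros j Hj; rewrite in_cup, pairing.
    intros [H | H]; [apply (Hk j); auto; lia|].
    assert (j = i) by (apply Hinj; tauto); lia.
  + exists k; intros j Hj; rewrite in_cup, pairing.
    intros [H | H]; [exact (Hk j Hj H)|].
    apply Hx; exists j; tauto.
Qed.

End SetBasics.

(** * Merging closure conditions, and null sets of NS↾S *)

Section ClosureFunctions.
Context {V : ZFC}.
Implicit Types a b S M X : V.

(* Given distinct points [e k], the value [F n a] is read off the finite set
   a ∪ {e k, e (k+1)}, where k codes n and exceeds the index of every e j ∈ a.
   The values G {e k} = e (k+1) make all the e k available. *)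
Lemma common_closure_function X (e : nat -> V) (F : nat -> V -> V) :
  (forall n, e n ∈ X) -> (forall m n, e m = e n -> m = n) ->
  (forall n, finitary_fun X (F n)) ->
  exists G, finitary_fun X G /\
    forall M, closure_point G M -> forall n, closure_point (F n) M.
Proof.
intros He Hinj HF.
set (R := fun b v =>
  (exists k, b = upair (e k) (e k) /\ v = e (S k)) \/
  (exists a n m, finite_set a /\
     (forall j, to_nat (n, m) <= j -> ~ e j ∈ a) /\
     b = cup a (upair (e (to_nat (n, m))) (e (S (to_nat (n, m))))) /\
     v = F n a)).
(* Codes of the two kinds cannot collide, since the second kind contains two distinct points [e l],
   [e (S l)] ([K]). In the second kind, [e (S k)] has the largest index among the points [e j] of
   the code, so k is determined ([L]), hence n; deleting the two points then gives back a ([N]). *)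
assert (Runiq : forall b v w, R b v -> R b w -> v = w).
{ assert (K : forall k a l,
    upair (e k) (e k) <> cup a (upair (e l) (e (S l)))).
  { intros k a l E.
    assert (H1 : e l ∈ upair (e k) (e k))
      by (rewrite E, in_cup, pairing; auto).
    assert (H2 : e (S l) ∈ upair (e k) (e k))
      by (rewrite E, in_cup, pairing; auto).
    apply pairing in H1; apply pairing in H2.
    assert (l = k) by (apply Hinj; tauto).
    assert (S l = k) by (apply Hinj; tauto).
    lia. }
  assert (L : forall a a' k k', (forall j, k' <= j -> ~ e j ∈ a') ->
    cup a (upair (e k) (e (S k))) = cup a' (upair (e k') (e (S k'))) ->
    k <= k').
  { intros a a' k k' Ha' E.
    assert (H : e (S k) ∈ cup a' (upair (e k') (e (S k'))))
      by (rewrite <- E, in_cup, pairing; auto).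
    rewrite in_cup, pairing in H; destruct H as [H | [H | H]].
    - destruct (le_lt_dec k' (S k)) as [Hk | Hk]; [|lia].
      destruct (Ha' _ Hk H).
    - apply Hinj in H; lia.
    - apply Hinj in H; lia. }
  assert (N : forall a a' k, (forall j, k <= j -> ~ e j ∈ a) ->
    cup a (upair (e k) (e (S k))) = cup a' (upair (e k) (e (S k))) ->
    a ⊆ a').
  { intros a a' k Ha E z Hz.
    assert (H : z ∈ cup a' (upair (e k) (e (S k))))
      by (rewrite <- E, in_cup; auto).
    rewrite in_cup, pairing in H; destruct H as [H | [-> | ->]]; auto.
    - destruct (Ha k); auto.
    - destruct (Ha (S k)); auto. }
  intros b v w [[k [-> ->]] | [a [n [m [Hfa [Ha [-> ->]]]]]]]
    [[k' [E ->]] | [a' [n' [m' [Hfa' [Ha' [E ->]]]]]]].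
  - assert (H : e k ∈ upair (e k') (e k')) by (rewrite <- E, pairing; auto).
    apply pairing in H; f_equal; f_equal; apply Hinj; tauto.
  - destruct (K _ _ _ E).
  - symmetry in E; destruct (K _ _ _ E).
  - assert (Ek : to_nat (n, m) = to_nat (n', m')).
    { apply Nat.le_antisymm; [apply (L a a') | apply (L a' a)]; auto. }
    pose proof (to_nat_inj _ _ Ek) as Enm; injection Enm as <- <-.
    f_equal; apply subset_antisym; eapply N; eauto. }
(* The default value matters: the empty set is not a code, so [G empty = e 0], which starts the
   induction putting every [e k] into a closure point of [G]. *)
set (Q := fun b v => R b v \/ ((~ exists w, R b w) /\ v = e 0)).
set (G := fun b => epsilon (inhabits empty) (Q b)).
assert (GQ : forall b, Q b (G b)).
{ intros b; apply epsilon_spec; unfold Q.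
  destruct (classic (exists w, R b w)) as [[w H] | H]; eauto. }
assert (GR : forall b v, R b v -> G b = v).
{ intros b v H; destruct (GQ b) as [H' | [H' _]]; [eauto|].
  destruct H'; eauto. }
exists G; split.
- intros b Hb HbX; destruct (GQ b) as [H | [_ ->]]; auto.
  destruct H as [[k [_ ->]] | [a [n [m [Hfa [_ [-> ->]]]]]]]; auto.
  apply HF; auto; intros w Hw; apply HbX; rewrite in_cup; auto.
- intros M HM n a Hfa HaM.
  assert (HeM : forall k, e k ∈ M).
  { induction k as [|k IH].
    - destruct (GQ empty) as [H | [_ <-]].
      + exfalso; destruct H as [[k [E _]] | [b [i [m [_ [_ [E _]]]]]]].
        * apply (@not_in_empty V (e k)); rewrite E, pairing; auto.
        * apply (@not_in_empty V (e (to_nat (i, m)))).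
          rewrite E, in_cup, pairing; auto.
      + apply HM; [constructor|]; intros w Hw; destruct (not_in_empty Hw).
    - rewrite <- (GR (upair (e k) (e k)) (e (S k))); [|left; eauto].
      apply HM; [apply finite_singleton|].
      intros w Hw; apply pairing in Hw; destruct Hw as [-> | ->]; auto. }
  destruct (finite_avoids_tail Hinj Hfa) as [m Hm].
  (* The second component is padding: [to_nat (n, m)] is at least [m], beyond which no [e j] lies in
     a. *)
  set (k := to_nat (n, m)).
  assert (Hk : m <= k) by (pose proof (to_nat_non_decreasing n m); unfold k; lia).
  rewrite <- (GR (cup a (upair (e k) (e (S k)))) (F n a)).
  + apply HM.
    * replace (cup a (upair (e k) (e (S k)))) with
        (cup (cup a (upair (e k) (e k))) (upair (e (S k)) (e (S k)))).
      { constructor; constructor; auto. }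
      apply extensionality; intros z; rewrite !in_cup, !pairing; tauto.
    * intros w; rewrite in_cup, pairing; intros [H | [-> | ->]]; auto.
  + right; exists a, n, m; repeat split; auto.
    intros j Hj; apply Hm; lia.
Qed.

(** This replaces membership in the generated ideal by a single function. Induction on the
    generation works because the functions for the two halves of a union can be merged; the points
    [e n] are there for that merging. *)
Lemma NS_restr_closure_function S (e : nat -> V) B :
  (forall n, e n ∈ sUnion S) -> (forall m n, e m = e n -> m = n) ->
  NS_restr S B ->
  exists g, finitary_fun (sUnion S) g /\
    forall M, M ∈ S -> closure_point g M -> ~ M ∈ B.
Proof.
intros He Hinj; induction 1 as
  [|f Hf|A B _ [g [Hg HA]] _ [h [Hh HB]]|A B _ [g [Hg HB]] HAB].
- exists (fun _ => e 0); split; [intros a _ _; auto|].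
  intros M HM _; rewrite in_diff; tauto.
- exists f; split; auto; intros M HM HfM; rewrite separation; tauto.
- destruct (@common_closure_function (sUnion S) e
    (fun n => match n with 0 => g | _ => h end) He Hinj) as [k [Hk HkM]].
  { intros [|n]; auto. }
  exists k; split; auto; intros M HM Hc; rewrite in_cup.
  intros [H | H];
    [exact (HA M HM (HkM M Hc 0) H) | exact (HB M HM (HkM M Hc 1) H)].
- exists g; split; auto; intros M HM Hc HA; apply (HB M); auto.
Qed.

End ClosureFunctions.

(** * Diagonal unions over finite sets for a normal, fine, countably complete ideal *)

Section NormalIdeals.
Context {V : ZFC} (y J : V).
Hypotheses (J_ideal : is_ideal (power y) J) (J_normal : normal y J)
  (J_fine : fine y J) (J_complete : countably_complete (power y) J).

Lemma ideal_subset A B : B ∈ J -> A ⊆ B -> A ∈ J.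
Proof. destruct J_ideal as [_ [_ [_ [H _]]]]; apply H. Qed.

Lemma ideal_cup A B : A ∈ J -> B ∈ J -> cup A B ∈ J.
Proof. destruct J_ideal as [_ [_ [_ [_ H]]]]; apply H. Qed.

Lemma ideal_empty : empty ∈ J.
Proof. destruct J_ideal as [_ [H _]]; exact H. Qed.

Lemma ideal_sub A : A ∈ J -> A ⊆ power y.
Proof. destruct J_ideal as [H _]; apply H. Qed.

(** The points added may repeat, so k is only an upper bound for the size. An external bound allows
    induction on k and then a countable union over k. *)
Fixpoint card_le (k : nat) (a : V) : Prop :=
  match k with
  | 0 => a = empty
  | S k => exists b u, card_le k b /\ a = cup b (upair u u)
  end.

Lemma finite_card_le (a : V) : finite_set a -> exists k, card_le k a.
Proof.
induction 1 as [|a x _ [k Hk]].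
- exists 0; reflexivity.
- exists (S k), a, x; auto.
Qed.

Lemma card_le_diagonal_union k (B : V -> V) :
  (forall a, a ⊆ y -> B a ∈ J) ->
  sep (power y) (fun M => exists a, card_le k a /\ a ⊆ M /\ M ∈ B a) ∈ J.
Proof.
revert B; induction k as [|k IH]; intros B HB.
- apply ideal_subset with (B empty).
  { apply HB; intros w Hw; destruct (not_in_empty Hw). }
  intros M; rewrite separation; intros [_ [a [-> [_ H]]]]; exact H.
(* One use of normality takes care of the last point u, the induction hypothesis of the others.
   Intersecting with y makes every argument of [B] visibly a subset of y, and changes nothing when
   the argument is contained in some M ⊆ y. *)
- apply ideal_subset with (sep (power y) (fun M => exists u, u ∈ M /\
    M ∈ sep (power y) (fun M => exists a, card_le k a /\ a ⊆ M /\
      M ∈ B (cap (cup a (upair u u)) y)))).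
  { apply (J_normal (F := fun u => sep (power y) (fun M =>
      exists a, card_le k a /\ a ⊆ M /\ M ∈ B (cap (cup a (upair u u)) y)))).
    intros u Hu.
    apply (IH (fun a => B (cap (cup a (upair u u)) y))).
    intros a Ha; apply HB; intros w; rewrite in_cap; tauto. }
  intros M; rewrite !separation.
  intros [HM [a [[b [u [Hb ->]]] [Ha HMa]]]].
  split; auto; exists u; split; [apply Ha; rewrite in_cup, pairing; auto|].
  rewrite separation; split; auto; exists b; split; auto; split.
  { intros w Hw; apply Ha; rewrite in_cup; auto. }
  rewrite cap_subset_eq; auto.
  intros w Hw; rewrite powerset in HM; auto.
Qed.

(** Normality handles each bound on the size separately; countable completeness joins the bounds. *)
Lemma finite_diagonal_union (B : V -> V) :
  (forall a, a ⊆ y -> B a ∈ J) ->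
  sep (power y) (fun M => exists a, finite_set a /\ a ⊆ M /\ M ∈ B a) ∈ J.
Proof.
intros HB.
eapply ideal_subset; [apply J_complete; intros k;
  exact (card_le_diagonal_union k HB)|].
intros M; rewrite !separation; intros [HM [a [Ha [HaM HMB]]]]; split; auto.
destruct (finite_card_le Ha) as [k Hk]; exists k.
rewrite separation; eauto.
Qed.

(** For a fixed finite a with [F a ∈ y], the M omitting [F a] form a null set by fineness. A
    diagonal union over a finishes. *)
Lemma nonclosed_in_ideal (F : V -> V) :
  sep (power y) (fun M =>
    ~ forall a, finite_set a -> a ⊆ M -> F a ∈ y -> F a ∈ M) ∈ J.
Proof.
eapply ideal_subset; [apply (@finite_diagonal_union
  (fun a => sep (power y) (fun M => F a ∈ y /\ ~ F a ∈ M)))|].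
- intros a _; destruct (classic (F a ∈ y)) as [H | H].
  + eapply ideal_subset; [exact (J_fine H)|].
    intros M; rewrite !separation; tauto.
  + eapply ideal_subset; [exact ideal_empty|].
    intros M; rewrite separation; tauto.
- intros M; rewrite !separation; intros [HM H]; split; auto.
  apply NNPP; intros H'; apply H; intros a Ha HaM HFa.
  apply NNPP; intros HFM; apply H'.
  exists a; rewrite separation; auto.
Qed.

Lemma diagonal_union2 (B : V -> V -> V) :
  (forall u v, u ∈ y -> v ∈ y -> B u v ∈ J) ->
  sep (power y) (fun M => exists u v, u ∈ M /\ v ∈ M /\ M ∈ B u v) ∈ J.
Proof.
intros HB.
eapply ideal_subset; [apply (J_normal (F := fun u =>
  sep (power y) (fun M => exists v, v ∈ M /\ M ∈ B u v)))|].
- intros u Hu; apply J_normal; auto.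
- intros M; rewrite !separation; intros [HM [u [v [Hu [Hv H]]]]]; split; auto.
  exists u; rewrite separation; eauto.
Qed.

End NormalIdeals.

(** * Dependent choice and infinite descent *)

Lemma dependent_choice (A : Type) (P : A -> Prop) (R : A -> A -> Prop) :
  (exists p, P p) -> (forall p, P p -> exists q, P q /\ R q p) ->
  exists u : nat -> A, forall n, P (u n) /\ R (u (S n)) (u n).
Proof.
intros [p Hp] H.
set (next := fun p => epsilon (inhabits p) (fun q => P q /\ R q p)).
assert (N : forall p, P p -> P (next p) /\ R (next p) p).
{ intros q Hq; apply (epsilon_spec (inhabits q) (fun r => P r /\ R r q)); auto. }
set (u := fun n => Nat.iter n next p).
assert (Hu : forall n, P (u n)).
{ induction n as [|n IH]; [exact Hp | exact (proj1 (N _ IH))]. }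
exists u; intros n; split; [apply Hu | exact (proj2 (N _ (Hu n)))].
Qed.

Lemma well_founded_or_descending (A : Type) (R : A -> A -> Prop) :
  well_founded R \/ exists u : nat -> A, forall n, R (u (S n)) (u n).
Proof.
destruct (classic (exists p, ~ Acc R p)) as [H | H].
- right; destruct (@dependent_choice A (fun p => ~ Acc R p) R H) as [u Hu].
  + intros p Hp; apply NNPP; intros Hn; apply Hp; constructor; intros q Hq.
    apply NNPP; intros Hq'; apply Hn; eauto.
  + exists u; intros n; apply Hu.
- left; intros p; apply NNPP; eauto.
Qed.

(** * The levels V_{kap n} and the ideals of the tower *)

Section Tower.
Context {V : ZFC} (lam : V) (kap : nat -> V) (I : V -> V).
Hypotheses (lam_ordinal : is_ordinal lam)
  (kap_cardinal : forall n, is_cardinal (kap n))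
  (kap_cofinal : increasing_cofinal kap lam)
  (I_tower : is_tower lam I).
Implicit Types a b f s t x y z A M T p q r : V.
Implicit Types F : V -> V.

Local Notation W n := (Vset (kap n)).

Lemma kap_transitive n : is_transitive (kap n).
Proof. destruct (kap_cardinal n) as [[H _] _]; exact H. Qed.

Lemma W_transitive n : is_transitive (W n).
Proof. apply Vset_transitive, kap_transitive. Qed.

Lemma Vlam_transitive : is_transitive (Vset lam).
Proof. exact (Vset_transitive (proj1 lam_ordinal)). Qed.

Lemma W_in_Vlam n : W n ∈ Vset lam.
Proof. apply Vset_in; apply kap_cofinal. Qed.

Lemma W_mono m n : m <= n -> W m ⊆ W n.
Proof.
induction 1 as [|n _ IH]; [auto|].
intros w Hw; apply (Vset_mono (@kap_transitive (S n)) (proj1 kap_cofinal n)); auto.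
Qed.

Lemma W_in_W m n : m < n -> W m ∈ W n.
Proof.
intros H; apply (@W_mono (S m) n H), Vset_in, kap_cofinal.
Qed.

Lemma W_inj m n : W m = W n -> m = n.
Proof.
intros E; destruct (lt_eq_lt_dec m n) as [[H | H] | H]; [|exact H|];
  apply W_in_W in H; rewrite E in H; destruct (mem_irrefl H).
Qed.

Lemma W_subset_Vlam n : W n ⊆ Vset lam.
Proof. exact (Vlam_transitive (W_in_Vlam n)). Qed.

Lemma Vlam_cofinal x : x ∈ Vset lam -> exists n, x ∈ W n.
Proof.
intros H; apply in_Vset in H; destruct H as [b [Hb H]].
destruct (proj2 (proj2 kap_cofinal) b Hb) as [n Hn].
exists n; apply in_Vset; eauto.
Qed.

(** If x is in V_{kap n}, so are all its subsets, whence A appears by the next level. Thus a null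
    set A ∈ I_x can itself be an element of some M ⊆ V_lam, as the use of goodness requires. *)
Lemma power_subset_Vlam x A : x ∈ Vset lam -> A ⊆ power x -> A ∈ Vset lam.
Proof.
intros Hx HA; destruct (Vlam_cofinal Hx) as [n Hn].
apply in_Vset; exists (kap n); split; [apply kap_cofinal|].
intros M HM; apply HA in HM; rewrite powerset in HM.
apply in_Vset in Hn; destruct Hn as [b [Hb Hn]].
apply in_Vset; exists b; auto.
Qed.

Lemma tower_ideal x : x ∈ Vset lam -> is_ideal (power x) (I x).
Proof. intros H; apply I_tower; exact H. Qed.

Lemma tower_normal x : x ∈ Vset lam -> normal x (I x).
Proof. intros H; apply I_tower; exact H. Qed.

Lemma tower_fine x : x ∈ Vset lam -> fine x (I x).
Proof. intros H; apply I_tower; exact H. Qed.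

Lemma tower_complete x : x ∈ Vset lam -> countably_complete (power x) (I x).
Proof. intros H; apply I_tower; exact H. Qed.

Lemma tower_lift x y A : x ∈ Vset lam -> y ∈ Vset lam -> x ⊆ y ->
  A ⊆ power x -> (A ∈ I x <-> lift x y A ∈ I y).
Proof. intros Hx Hy Hxy; apply I_tower; auto. Qed.

Lemma tower_subset x A : x ∈ Vset lam -> A ∈ I x -> A ⊆ power x.
Proof. intros Hx; apply (ideal_sub (tower_ideal Hx)). Qed.

Lemma tower_lift_in x y A : x ∈ Vset lam -> y ∈ Vset lam -> x ⊆ y ->
  A ∈ I x -> lift x y A ∈ I y.
Proof.
intros Hx Hy Hxy HA; apply tower_lift; auto.
apply tower_subset; auto.
Qed.

(** * Good sets and the tree of their approximations *)

Definition good M : Prop :=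
  forall x A, x ∈ M -> A ∈ M -> x ∈ Vset lam -> A ∈ I x -> ~ cap M x ∈ A.

(** Closure is demanded only for values that already lie in y; other values are left to higher
    levels. *)
Definition approximation (F : V -> V) x T y M : Prop :=
  M ⊆ y /\ (forall a, finite_set a -> a ⊆ M -> F a ∈ y -> F a ∈ M) /\
  good M /\ cap M x ∈ T.

(** As y is transitive, x ∈ y gives x ⊆ y, so each A ∈ I_x lifts to a null set of I_y. The M that
    fail to be good lie in the diagonal union of these lifts over pairs x, A. *)
Lemma nongood_in_ideal y : y ∈ Vset lam -> is_transitive y ->
  sep (power y) (fun M => ~ good M) ∈ I y.
Proof.
intros Hy Hty.
eapply (ideal_subset (tower_ideal Hy)).
- apply (@diagonal_union2 V y (I y) (tower_ideal Hy) (tower_normal Hy)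
    (fun x A => sep (lift x y A) (fun _ => x ∈ Vset lam /\ A ∈ I x))).
  intros x A Hx HA.
  destruct (classic (x ∈ Vset lam /\ A ∈ I x)) as [[H1 H2] | H].
  + apply (ideal_subset (tower_ideal Hy) (tower_lift_in H1 Hy (Hty x Hx) H2)).
    intros M; rewrite separation; tauto.
  + apply (ideal_subset (tower_ideal Hy) (ideal_empty (tower_ideal Hy))).
    intros M; rewrite separation; tauto.
- intros M; rewrite !separation; intros [HM H]; split; auto.
  apply NNPP; intros H'; apply H; intros x A Hx HA Hxl HAI HMA; apply H'.
  exists x, A; rewrite separation, in_lift; rewrite powerset in HM; auto.
Qed.

Lemma approximation_large (F : V -> V) x T y :
  y ∈ Vset lam -> is_transitive y ->
  diff (lift x y T) (sep (power y) (approximation F x T y)) ∈ I y.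
Proof.
intros Hy Hty.
apply (ideal_subset (tower_ideal Hy) (ideal_cup (tower_ideal Hy)
  (nonclosed_in_ideal (tower_ideal Hy) (tower_normal Hy) (tower_fine Hy)
    (tower_complete Hy) F) (nongood_in_ideal Hy Hty))).
intros M; rewrite in_diff, in_lift, in_cup, !separation, powerset.
intros [[HM HT] H].
apply NNPP; intros H'; apply H; split; auto; repeat split; auto;
  apply NNPP; tauto.
Qed.

(** By coherence the union of the [u i] has trace [u i] on level [m + i]. Each instance of closure
    or goodness involves finitely many points, so it can be checked at one sufficiently high
    level. *)
Lemma union_of_branch (F : V -> V) x T m (u : nat -> V) :
  finitary_fun (Vset lam) F -> x ⊆ W m ->
  (forall i, approximation F x T (W (m + i)) (u i)) ->
  (forall i, u i = cap (u (S i)) (W (m + i))) ->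
  exists M, M ⊆ Vset lam /\ good M /\ closure_point F M /\ cap M x ∈ T.
Proof.
intros HF Hx Hu Hcoh.
assert (Hmono : forall i k, u i ⊆ u (k + i)).
{ intros i; induction k as [|k IH]; [auto|].
  intros w Hw; apply IH in Hw; rewrite Hcoh, in_cap in Hw; apply Hw. }
assert (Hres : forall i k w, w ∈ u (k + i) -> w ∈ W (m + i) -> w ∈ u i).
{ intros i; induction k as [|k IH]; [auto|].
  intros w Hw HwW; apply IH; auto; rewrite Hcoh, in_cap; split; auto.
  apply (@W_mono (m + i)); [lia | auto]. }
set (M := sep (Vset lam) (fun z => exists i, z ∈ u i)).
assert (HM : forall i, cap M (W (m + i)) = u i).
{ intros i; apply extensionality; intros w; unfold M.
  rewrite in_cap, separation; split.
  - intros [[_ [j Hj]] Hw]; apply (Hres i j); auto.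
    rewrite Nat.add_comm; apply Hmono; exact Hj.
  - intros Hw; pose proof (proj1 (Hu i) _ Hw) as HwW.
    split; auto; split; eauto; apply (W_subset_Vlam HwW). }
assert (Hlevel : forall w, w ∈ Vset lam ->
  exists i, forall j, i <= j -> w ∈ W (m + j)).
{ intros w Hw; destruct (Vlam_cofinal Hw) as [n Hn]; exists n; intros j Hj.
  apply (@W_mono n); [lia | auto]. }
assert (Hfin : forall a, finite_set a -> a ⊆ M ->
  exists i, forall j, i <= j -> a ⊆ u j).
{ induction 1 as [|a b _ IH]; intros Ha.
  - exists 0; intros j _ w Hw; destruct (not_in_empty Hw).
  - destruct IH as [i Hi]; [intros w Hw; apply Ha; rewrite in_cup; auto|].
    assert (Hb : b ∈ M) by (apply Ha; rewrite in_cup, pairing; auto).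
    unfold M in Hb; rewrite separation in Hb; destruct Hb as [_ [k Hk]].
    exists (max i k); intros j Hj w; rewrite in_cup, pairing.
    intros [Hw | Hw]; [apply (Hi j); auto; lia|].
    assert (w = b) as -> by tauto.
    replace j with (j - k + k) by lia; apply Hmono; exact Hk. }
assert (HMl : M ⊆ Vset lam) by (intros w; unfold M; rewrite separation; tauto).
exists M; repeat split; auto.
- intros z A Hz HA Hzl HAI.
  destruct (Hlevel z Hzl) as [i Hi].
  destruct (Hlevel A (HMl A HA)) as [k Hk].
  set (j := max i k).
  destruct (Hu j) as [_ [_ [HG _]]].
  assert (Hzj : z ∈ W (m + j)) by (apply Hi; lia).
  rewrite <- (@cap_cap V z (W (m + j)) M); [|exact (W_transitive Hzj)].
  rewrite HM; apply HG; auto; rewrite <- HM, in_cap; split; auto.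
  apply Hk; lia.
- intros a Ha HaM; destruct (Hfin a Ha HaM) as [i Hi].
  assert (HFa : F a ∈ Vset lam) by (apply HF; auto).
  destruct (Hlevel _ HFa) as [k Hk].
  set (j := max i k).
  destruct (Hu j) as [_ [HFj _]].
  unfold M; rewrite separation; split; auto; exists j.
  apply HFj; auto; [apply Hi; lia | apply Hk; lia].
- rewrite <- (@cap_cap V x (W (m + 0)) M), HM; [apply Hu|].
  rewrite Nat.add_0_r; auto.
Qed.

(** Put as an alternative so that precipitousness and wellfoundedness of the ground-model ultrapower
    can each refute the second case. *)
Lemma closed_good_or_descending (F : V -> V) x T :
  finitary_fun (Vset lam) F -> x ∈ Vset lam ->
  (exists M, M ⊆ Vset lam /\ good M /\ closure_point F M /\ cap M x ∈ T) \/
  exists f : nat -> V, (forall n, represents lam (f n)) /\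
    forall n, exists k A, x ⊆ W k /\
      membership_set lam (f (S n)) (f n) (W k) A /\
      diff (lift x (W k) T) A ∈ I (W k).
Proof.
intros HF Hx.
destruct (Vlam_cofinal Hx) as [m Hm].
pose proof (W_transitive Hm) as Hxm.
(* A node is a level together with a subset; [R q p] says that q is an approximation one level above
   p with trace p. *)
set (R := fun q p : nat * V => fst q = S (fst p) /\
  approximation F x T (W (m + fst q)) (snd q) /\
  snd p = cap (snd q) (W (m + fst p))).
destruct (well_founded_or_descending R) as [Hwf | [u Hu]].
- right.
  (* Ranks need not be ordinals: [rho p] is a set having the rank of every successor of p as an
     element. Subsets that are not successors contribute [empty], which does no harm, since only
     [Hrho] is needed. *)
  set (rho := Fix Hwf (fun _ => carrier V) (fun (p : nat * V) rec =>
    image (power (W (m + S (fst p)))) (fun M =>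
      match excluded_middle_informative (R (S (fst p), M) p) with
      | left h => rec _ h
      | right _ => empty
      end))).
  assert (rhoE : forall p : nat * V, rho p =
    image (power (W (m + S (fst p)))) (fun M =>
      if excluded_middle_informative (R (S (fst p), M) p)
      then rho (S (fst p), M) else empty)).
  { intros p; unfold rho at 1; rewrite Fix_eq; [reflexivity|].
    intros q f g Hfg; f_equal.
    apply FunctionalExtensionality.functional_extensionality.
    intros M; destruct (excluded_middle_informative _); auto. }
  assert (Hrho : forall n M, approximation F x T (W (m + S n)) M ->
    rho (S n, M) ∈ rho (n, cap M (W (m + n)))).
  { intros n M HM; rewrite (rhoE (n, _)); apply replacement.
    exists M; split; [apply powerset, HM|]; simpl.
    destruct (excluded_middle_informative _) as [_ | H]; [reflexivity|].
    destruct H; unfold R; simpl; auto. }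
  exists (fun n => image (power (W (m + n))) (fun M => opair M (rho (n, M)))).
  split.
  { intros n; exists (W (m + n)); split; [apply W_in_Vlam|].
    apply is_fun_on_graph. }
  (* The comparison takes place on the domain of the higher function; the membership set there
     contains all approximations. *)
  intros n; exists (m + S n); eexists; split; [|split].
  + intros w Hw; apply (@W_mono m); [lia | auto].
  + exists (W (m + S n)), (W (m + n)).
    split; [apply W_in_Vlam|]; split; [apply W_in_Vlam|].
    split; [apply W_in_Vlam|]; split; [apply is_fun_on_graph|].
    split; [apply is_fun_on_graph|]; split; [auto|].
    split; [apply W_mono; lia | reflexivity].
  + apply (ideal_subset (tower_ideal (W_in_Vlam _))
      (approximation_large F x T (W_in_Vlam _) (@W_transitive _))).
    intros M; rewrite !in_diff, !separation.
    intros [HMT H]; split; auto; intros [HM HA]; apply H; split; auto.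
    exists (rho (S n, M)), (rho (n, cap M (W (m + n)))).
    rewrite powerset in HM.
    rewrite cap_subset_eq by auto.
    rewrite !in_graph, !powerset; repeat split; auto.
    intros w; rewrite in_cap; tauto.
- left.
  (* [R] makes only its first argument an approximation, so [u 0] is dropped and the branch starts
     at [u 1]. *)
  set (k := fst (u 1)).
  assert (Hk : forall i, fst (u (S i)) = k + i).
  { induction i as [|i IH]; [unfold k; lia|].
    destruct (Hu (S i)) as [-> _]; lia. }
  apply (@union_of_branch F x T (m + k) (fun i => snd (u (S i)))); auto.
  + intros w Hw; apply (@W_mono m); [lia | auto].
  + intros i; destruct (Hu i) as [_ [H _]]; rewrite Hk in H.
    rewrite <- Nat.add_assoc; exact H.
  + intros i; destruct (Hu (S i)) as [_ [_ H]]; rewrite Hk in H.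
    rewrite <- Nat.add_assoc; exact H.
Qed.

(** * The good sets as a stationary set projecting to the tower *)

Lemma canonical_projection_of_good :
  (forall F x T, finitary_fun (Vset lam) F -> x ∈ Vset lam ->
    positive (power x) (I x) T ->
    exists M, M ⊆ Vset lam /\ good M /\ closure_point F M /\ cap M x ∈ T) ->
  canonical_projection_of_NS lam I.
Proof.
intros H.
set (S := sep (power (Vset lam)) good).
assert (H0 : empty ∈ Vset lam).
{ apply (@power_subset_Vlam (W 0)); [apply W_in_Vlam|].
  intros w Hw; destruct (not_in_empty Hw). }
assert (HS : forall F x T, finitary_fun (Vset lam) F -> x ∈ Vset lam ->
  positive (power x) (I x) T ->
  exists M, M ∈ S /\ closure_point F M /\ cap M x ∈ T).
{ intros F x T HF Hx HT; destruct (H F x T HF Hx HT) as [M [HM [HG HM']]].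
  exists M; split; auto; unfold S; rewrite separation, powerset; auto. }
(* The positive set ℘(∅) puts no condition on M; with it the hypothesis yields both ⋃S = V_lam and
   stationarity. *)
assert (Hpos : positive (power empty) (I empty) (power (empty : V))).
{ split; [auto | apply (tower_ideal H0)]. }
assert (HU : sUnion S = Vset lam).
{ apply subset_antisym.
  - intros w; rewrite union; intros [M [HM Hw]]; unfold S in HM.
    rewrite separation, powerset in HM; apply HM; exact Hw.
  - intros w Hw; rewrite union.
    destruct (HS (fun _ => w) empty (power empty)) as [M [HM [HwM _]]]; auto.
    { intros a _ _; exact Hw. }
    exists M; split; auto; apply (HwM empty); [constructor|].
    intros z Hz; destruct (not_in_empty Hz). }
exists S; split; [|split].
- intros F; rewrite HU; intros HF.
  destruct (HS F empty (power empty)) as [M [HM [HFM _]]]; eauto.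
- rewrite HU; auto.
- intros x Hx A HA; split.
  + intros HAI.
    assert (HAl : A ∈ Vset lam) by exact (power_subset_Vlam Hx HA).
    (* A closure point of a constant function contains the constant. So outside these two sets M
       contains x and A, and goodness forbids M ∩ x ∈ A. *)
    apply NS_subset with (cup
      (sep (power (sUnion S)) (fun M => ~ closure_point (fun _ => x) M))
      (sep (power (sUnion S)) (fun M => ~ closure_point (fun _ => A) M))).
    { apply NS_cup; apply NS_nonclosed; rewrite HU; intros a _ _; auto. }
    intros M; rewrite HU, separation, in_cup, !separation; intros [HM HMA].
    unfold S in HM; rewrite separation in HM; destruct HM as [HM HG].
    apply NNPP; intros Hc.
    assert (K : forall w, closure_point (fun _ => w) M -> w ∈ M).
    { intros w Hw; apply (Hw empty); [constructor|].
      intros z Hz; destruct (not_in_empty Hz). }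
    apply (HG x A); auto; apply K; apply NNPP; tauto.
  + intros HNS; apply NNPP; intros HAI.
    destruct (@NS_restr_closure_function V S (fun n => W n)
      (sep S (fun M => cap M x ∈ A))) as [g [Hg HgM]]; auto.
    { intros n; rewrite HU; apply W_in_Vlam. }
    { apply W_inj. }
    rewrite HU in Hg.
    destruct (HS g x A) as [M [HM [HMg HMA]]]; auto.
    { split; auto. }
    apply (HgM M HM HMg); rewrite separation; auto.
Qed.

(** * The ultrapower in the ground model *)

Lemma ult_wellfounded_of_projection :
  canonical_projection_of_NS lam I -> ult_wellfounded lam I.
Proof.
intros [S [HS [HlS Hproj]]] X Hne Hrep.
apply NNPP; intros Hmin.
destruct (@dependent_choice V (fun f => f ∈ X) (ult_mem lam I)) as [f Hf]; auto.
{ intros p Hp; apply NNPP; intros H; apply Hmin; exists p; split; auto.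
  intros g Hg Hgp; apply H; eauto. }
(* The domain is quantified inside because [f n] occurs in two consecutive membership statements,
   each with its own witness for it; [Hval] shows that these agree. *)
set (value := fun n M v => exists x,
  is_fun_on (f n) (power x) /\ opair (cap M x) v ∈ f n).
assert (Hval : forall n M v w, value n M v -> value n M w -> v = w).
{ intros n M v w [x [Hx Hv]] [x' [Hx' Hw]].
  rewrite <- (power_inj (is_fun_on_dom Hx Hx')) in Hw.
  destruct (proj2 Hx (cap M x)) as [z [_ Hz]].
  { rewrite powerset; intros t; rewrite in_cap; tauto. }
  rewrite <- (Hz v Hv), <- (Hz w Hw); reflexivity. }
set (step := fun n (g : V -> V) => finitary_fun (sUnion S) g /\
  forall M, M ∈ S -> closure_point g M ->
    exists u v, value (Datatypes.S n) M u /\ value n M v /\ u ∈ v).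
assert (Hstep : forall n, exists g, step n g).
{ intros n; destruct (Hf n) as [_ [y [A [HA HAd]]]].
  destruct HA as [x [x' [Hx [Hx' [Hy [Hfx [Hfx' [Hxy [Hxy' EA]]]]]]]]].
  unfold dual in HAd; rewrite separation in HAd; destruct HAd as [_ HAd].
  apply (Hproj y Hy) in HAd; [|intros w; rewrite in_diff; tauto].
  apply (@NS_restr_closure_function V S (fun n => W n)) in HAd;
    [|intros k; apply HlS, W_in_Vlam | apply W_inj].
  destruct HAd as [g [Hg HgM]].
  exists g; split; auto; intros M HM HMg; apply (HgM M HM) in HMg.
  rewrite separation, in_diff in HMg.
  assert (HMy : cap M y ∈ power y)
    by (rewrite powerset; intros w; rewrite in_cap; tauto).
  assert (HMA : cap M y ∈ A) by (apply NNPP; tauto).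
  rewrite EA, separation, !cap_cap in HMA by auto.
  destruct HMA as [_ [u [v [Hu [Hv Huv]]]]].
  exists u, v; repeat split; auto; [exists x | exists x']; auto. }
set (g := fun n => epsilon (inhabits (fun a : V => a)) (step n)).
assert (Hg : forall n, step n (g n)) by (intros n; apply epsilon_spec, Hstep).
destruct (@common_closure_function V (sUnion S) (fun n => W n) g) as [G [HG HGg]].
{ intros k; apply HlS, W_in_Vlam. }
{ apply W_inj. }
{ intros n; apply Hg. }
destruct (HS G HG) as [M [HM HMG]].
apply (@no_descending_sequence V (fun n => epsilon (inhabits empty) (value n M))).
intros n; destruct (proj2 (Hg n) M HM (HGg M HMG n)) as [u [v [Hu [Hv Huv]]]].
assert (E : forall n w, value n M w ->
  epsilon (inhabits empty) (value n M) = w).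
{ intros i w Hw; apply (Hval i M); auto; apply epsilon_spec; eauto. }
rewrite (E _ _ Hu), (E _ _ Hv); exact Huv.
Qed.

(** Each A is positive, since otherwise the lift of T would be null. With ultrafilters it is then of
    measure one, so the range of f has no minimal element. *)
Lemma ult_wellfounded_not_descending x T (f : nat -> V) :
  (forall n, is_ultrafilter (power (W n)) (dual (power (W n)) (I (W n)))) ->
  ult_wellfounded lam I ->
  x ∈ Vset lam -> positive (power x) (I x) T ->
  (forall n, represents lam (f n)) ->
  ~ forall n, exists k A, x ⊆ W k /\
      membership_set lam (f (S n)) (f n) (W k) A /\
      diff (lift x (W k) T) A ∈ I (W k).
Proof.
intros HU Hwf Hx [HT HTI] Hrep Hf.
destruct (range_set f W_in_Vlam W_inj) as [X HX].
destruct (Hwf X) as [g [Hg Hmin]].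
{ exists (f 0); apply HX; eauto. }
{ intros g Hg; apply HX in Hg; destruct Hg as [n ->]; auto. }
apply HX in Hg; destruct Hg as [n ->].
destruct (Hf n) as [k [A [Hxk [HA HTA]]]].
apply (Hmin (f (S n))); [apply HX; eauto|].
exists (W k), A; split; [exact HA|].
assert (HAs : A ⊆ power (W k)).
{ destruct HA as [y [y' [_ [_ [_ [_ [_ [_ [_ ->]]]]]]]]].
  intros w; rewrite separation; tauto. }
unfold dual; rewrite separation, powerset; split; [exact HAs|].
destruct (HU k) as [_ [_ [_ [_ [_ HUk]]]]].
destruct (HUk A HAs) as [H | H]; unfold dual in H; rewrite separation in H;
  [apply H|].
exfalso; apply HTI; apply (tower_lift Hx (W_in_Vlam k) Hxk HT).
apply (ideal_subset (tower_ideal (W_in_Vlam k))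
  (ideal_cup (tower_ideal (W_in_Vlam k)) HTA (proj2 H))).
intros M HM; rewrite in_cup, !in_diff.
assert (M ∈ power (W k)) by (rewrite in_lift in HM; rewrite powerset; apply HM).
destruct (classic (M ∈ A)); tauto.
Qed.

(** * The tower forcing: its order, and forcing with check names *)

Lemma positive_base_unique x x' T : x ∈ Vset lam -> x' ∈ Vset lam ->
  positive (power x) (I x) T -> positive (power x') (I x') T -> x = x'.
Proof.
assert (K : forall z z', z ∈ Vset lam -> positive (power z) (I z) T ->
  positive (power z') (I z') T -> z ⊆ z').
{ intros z z' Hz [HT HTI] [HT' _] w Hw; apply NNPP; intros Hw'; apply HTI.
  apply (ideal_subset (tower_ideal Hz) (tower_fine Hz Hw)).
  intros M HM; rewrite separation; split; auto.
  intros HwM; apply Hw'; apply HT' in HM; rewrite powerset in HM; auto. }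
intros Hx Hx' HT HT'; apply subset_antisym; apply K; auto.
Qed.

Lemma lift_diff_in x x' y z T T' : y ∈ Vset lam -> z ∈ Vset lam ->
  x ⊆ y -> x' ⊆ y -> y ⊆ z ->
  diff (lift x y T) (lift x' y T') ∈ I y ->
  diff (lift x z T) (lift x' z T') ∈ I z.
Proof.
intros Hy Hz Hxy Hxy' Hyz H.
apply (ideal_subset (tower_ideal Hz) (tower_lift_in Hy Hz Hyz H)).
intros M; rewrite in_diff, !in_lift, in_diff, !in_lift, !cap_cap by auto.
assert (cap M y ⊆ y) by (intros w; rewrite in_cap; tauto).
tauto.
Qed.

Local Notation P := (B_tower lam I).
Local Notation "q ≼ p" := (extends P (B_le lam I) q p)
  (at level 70, no associativity).

Lemma B_le_trans p q r : B_le lam I p q -> B_le lam I q r -> B_le lam I p r.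
Proof.
intros [x [x' [y [Hx [Hx' [Hy [Hp [Hq [Hxy [Hxy' H]]]]]]]]]]
  [z' [z [w [Hz' [Hz [Hw [Hq' [Hr [Hzw' [Hzw H']]]]]]]]]].
(* Each comparison supplies its own base for q; fineness identifies them, and both comparisons can
   be lifted to a common level. *)
rewrite <- (positive_base_unique Hx' Hz' Hq Hq') in *.
destruct (Vlam_cofinal Hy) as [m Hm]; destruct (Vlam_cofinal Hw) as [n Hn].
assert (Hyk : y ⊆ W (max m n)).
{ intros t Ht; apply (@W_mono m); [lia|]; apply (W_transitive Hm); auto. }
assert (Hwk : w ⊆ W (max m n)).
{ intros t Ht; apply (@W_mono n); [lia|]; apply (W_transitive Hn); auto. }
pose proof (W_in_Vlam (max m n)) as Hk.
exists x, z, (W (max m n)); repeat split; auto; try apply Hp; try apply Hr.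
apply (ideal_subset (tower_ideal Hk) (ideal_cup (tower_ideal Hk)
  (lift_diff_in Hy Hk Hxy Hxy' Hyk H) (lift_diff_in Hw Hk Hzw' Hzw Hwk H'))).
intros M; rewrite in_cup, !in_diff.
destruct (classic (M ∈ lift x' (W (max m n)) q)); tauto.
Qed.

Lemma extends_trans p q r : p ≼ q -> q ≼ r -> p ≼ r.
Proof.
intros [Hp [_ Hpq]] [_ [Hr Hqr]]; repeat split; auto.
exact (B_le_trans Hpq Hqr).
Qed.

Lemma in_B_tower x T :
  x ∈ Vset lam -> positive (power x) (I x) T -> T ∈ P.
Proof.
intros Hx HT; unfold B_tower; rewrite separation, powerset; split.
- intros M HM; apply HT in HM; rewrite powerset in *.
  intros w Hw; apply (Vlam_transitive Hx); auto.
- exists x; auto.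
Qed.

Lemma extends_intro x y T T' : x ∈ Vset lam -> y ∈ Vset lam -> x ⊆ y ->
  positive (power x) (I x) T -> positive (power y) (I y) T' ->
  diff (lift x y T) T' ∈ I y -> T ≼ T'.
Proof.
intros Hx Hy Hxy HT HT' H; repeat split;
  [exact (in_B_tower Hx HT) | exact (in_B_tower Hy HT')|].
exists x, y, y; repeat split; auto; try apply HT; try apply HT'.
apply (ideal_subset (tower_ideal Hy) H).
intros M; rewrite !in_diff, !in_lift; intros [[HM HMT] HMT']; split; auto.
intros HM'; apply HMT'; split; auto; rewrite cap_subset_eq; auto.
Qed.

Lemma extends_refl p : p ∈ P -> p ≼ p.
Proof.
intros Hp; pose proof Hp as H; unfold B_tower in H; rewrite separation in H.
destruct H as [_ [x [Hx H]]]; apply (extends_intro Hx Hx); auto.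
apply (ideal_subset (tower_ideal Hx) (ideal_empty (tower_ideal Hx))).
intros M; rewrite in_diff, in_lift; intros [[HM HMp] HMp'].
rewrite cap_subset_eq in HMp; tauto.
Qed.

Lemma forces_eq_mono p q s t : q ≼ p ->
  forces_eq P (B_le lam I) p s t -> forces_eq P (B_le lam I) q s t.
Proof.
intros Hq H; destruct H as [p s t H1 H2]; constructor.
- intros s' u Hs q' Hq'; apply (H1 s' u Hs); exact (extends_trans Hq' Hq).
- intros t' v Ht q' Hq'; apply (H2 t' v Ht); exact (extends_trans Hq' Hq).
Qed.

Lemma in_check_pair a t u :
  opair t u ∈ check P a -> exists b, b ∈ a /\ t = check P b.
Proof.
intros H; apply in_check in H; destruct H as [b [p [Hb [_ E]]]].
apply opair_inj in E; destruct E; eauto.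
Qed.

Lemma forces_eq_check_refl a p :
  forces_eq P (B_le lam I) p (check P a) (check P a).
Proof.
revert p; induction (foundation a) as [a _ IH]; intros p; constructor;
  intros t u H q Hq; exists q; (split; [apply extends_refl, Hq|]);
  intros Hqu; exists t, u; (split; [exact H|]); (split; [exact Hqu|]);
  apply in_check_pair in H; destruct H as [b [Hb ->]]; apply IH; auto.
Qed.

Lemma is_name_check a : is_name P (check P a).
Proof.
induction (foundation a) as [a _ IH]; constructor; intros z Hz.
apply in_check in Hz; destruct Hz as [b [p [Hb [Hp ->]]]]; eauto 6.
Qed.

Lemma Fmem_check a b p :
  b ∈ a -> Fmem P (B_le lam I) (check P b) (check P a) p.
Proof.
intros Hb q Hq; exists q; split; [apply extends_refl, Hq|].
exists (check P b), q; split; [|split].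
- apply in_check; exists b, q; repeat split; auto; apply Hq.
- apply extends_refl, Hq.
- apply forces_eq_check_refl.
Qed.

Lemma Fmem_check_inv a s p q :
  Fmem P (B_le lam I) s (check P a) p -> q ≼ p ->
  exists r b, r ≼ q /\ b ∈ a /\ forces_eq P (B_le lam I) r s (check P b).
Proof.
intros H Hq; destruct (H q Hq) as [r [Hr [t [v [Ht [_ E]]]]]].
apply in_check_pair in Ht; destruct Ht as [b [Hb ->]]; eauto.
Qed.

Lemma Fmem_generic p A : p ≼ A ->
  Fmem P (B_le lam I) (check P A) (generic_name P) p.
Proof.
intros HpA q Hq; exists q; split; [apply extends_refl, Hq|].
exists (check P A), A; split; [|split].
- apply replacement; exists A; split; [apply HpA | reflexivity].
- exact (extends_trans Hq HpA).
- apply forces_eq_check_refl.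
Qed.

Lemma precipitous_not_descending x T (f : nat -> V) :
  precipitous lam I ->
  x ∈ Vset lam -> positive (power x) (I x) T ->
  (forall n, represents lam (f n)) ->
  ~ forall n, exists k A, x ⊆ W k /\
      membership_set lam (f (S n)) (f n) (W k) A /\
      diff (lift x (W k) T) A ∈ I (W k).
Proof.
intros Hprec Hx HT Hrep Hf.
assert (HTP : T ∈ P) by exact (in_B_tower Hx HT).
destruct (range_set f W_in_Vlam W_inj) as [X HX].
assert (HfX : forall n, f n ∈ X) by (intros n; apply HX; eauto).
(* Forced wellfoundedness is applied to the check name of the range of f, giving a name s for a
   minimal element. *)
destruct (Hprec T HTP (check P X) (is_name_check X) T (extends_refl HTP))
  with (q := T) as [p [HpT [s [Hs [HsX Hmin]]]]].
- split.
  + intros q Hq; exists q; split; [apply extends_refl, Hq|].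
    exists (check P (f 0)); split; [apply is_name_check|].
    apply Fmem_check; auto.
  + intros s Hs q Hq HsX r Hr.
    destruct (Fmem_check_inv HsX Hr) as [r' [b [Hr' [Hb E]]]].
    exists r'; split; auto; exists b; split; auto.
    apply HX in Hb; destruct Hb as [n ->]; auto.
- exact (extends_refl HTP).
(* The condition q decides which [f n] the name s denotes; minimality is refuted by [f (S n)]. *)
- destruct (Fmem_check_inv HsX (extends_refl (proj1 HpT))) as [q [b [Hq [Hb E]]]].
  apply HX in Hb; destruct Hb as [n ->].
  apply (Hmin _ (is_name_check (f (S n))) q Hq (Fmem_check (HfX (S n))) q).
  { apply extends_refl, Hq. }
  intros r Hr; exists r; split; [apply extends_refl, Hr|].
  exists (f (S n)); split; auto.
  intros r1 Hr1; exists r1; split; [apply extends_refl, Hr1|].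
  exists (f n); split; auto; split.
  { split; [apply forces_eq_check_refl|].
    exact (forces_eq_mono (extends_trans Hr1 Hr) E). }
  (* A is positive, as otherwise the lift of T would be null, and T ≼ A. All conditions considered
     here lie below T, so they force A into the generic filter. *)
  destruct (Hf n) as [k [A [Hxk [HA HTA]]]].
  pose proof (W_in_Vlam k) as Hk.
  assert (HAp : positive (power (W k)) (I (W k)) A).
  { split.
    - destruct HA as [y [y' [_ [_ [_ [_ [_ [_ [_ ->]]]]]]]]].
      intros w; rewrite separation; tauto.
    - intros HAI; apply (proj2 HT); apply (tower_lift Hx Hk Hxk (proj1 HT)).
      apply (ideal_subset (tower_ideal Hk) (ideal_cup (tower_ideal Hk) HTA HAI)).
      intros M HM; rewrite in_cup, in_diff.
      destruct (classic (M ∈ A)); tauto. }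
  intros r2 Hr2; exists r2; split; [apply extends_refl, Hr2|].
  exists A; split; [exists (W k); auto|].
  apply Fmem_generic.
  apply (extends_trans Hr2), (extends_trans Hr1), (extends_trans Hr),
    (extends_trans Hq), (extends_trans HpT).
  exact (extends_intro Hx Hk Hxk HT HAp HTA).
Qed.

End Tower.

Theorem theorem5p2 (V : ZFC) (lam : V) (kap : nat -> V) (I : V -> V)
  (lam_ordinal : is_ordinal lam)
  (lam_cofinality : is_cofinality lam omega)
  (kap_cardinal : forall n, is_cardinal (kap n))
  (kap_cofinal : increasing_cofinal kap lam)
  (I_tower : is_tower lam I) :
  (precipitous lam I -> canonical_projection_of_NS lam I) /\
  ((forall n, is_ultrafilter (power (Vset (kap n)))
                (dual (power (Vset (kap n))) (I (Vset (kap n))))) ->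
   (ult_wellfounded lam I <-> canonical_projection_of_NS lam I)).
Proof.
split.
- intros Hprec.
  apply (canonical_projection_of_good kap_cardinal kap_cofinal I_tower).
  intros F x T HF Hx HT.
  destruct (closed_good_or_descending lam_ordinal kap_cardinal kap_cofinal
    I_tower T HF Hx) as [H | [f [Hrep Hf]]]; [exact H|].
  destruct (precipitous_not_descending lam_ordinal kap_cardinal kap_cofinal
    I_tower Hprec Hx HT Hrep Hf).
- intros HU; split.
  + intros Hwf.
    apply (canonical_projection_of_good kap_cardinal kap_cofinal I_tower).
    intros F x T HF Hx HT.
    destruct (closed_good_or_descending lam_ordinal kap_cardinal kap_cofinal
      I_tower T HF Hx) as [H | [f [Hrep Hf]]]; [exact H|].
    destruct (ult_wellfounded_not_descending kap_cardinal kap_cofinal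
      I_tower HU Hwf Hx HT Hrep Hf).
  + exact (ult_wellfounded_of_projection kap_cardinal kap_cofinal (I := I)).
Qed.
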